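(* Let $B,b>0$. There exist real constants $C,c>0$, depending only on $B$ and $b$ (in particular not on $n$), such that the following holds for every integer $n\ge 1$. Let $M=(\xi_{i,j})_{1\le i,j\le n}$ be a random real $n\times n$ matrix whose coefficients $\xi_{i,j}$ are independent, have mean zero, and are uniformly sub-Gaussian with constants $B,b$, i.e. $\mathbb{P}(|\xi_{i,j}|>t)\le B\exp(-bt^2)$ for all $t>0$ and all $i,j$. Then $$\mathbb{P}\left(\|M\|_{op}>A\sqrt n\right)\le C\exp(-cAn)\qquad\text{for all } A\ge C.$$ In particular, $\|M\|_{op}=O(\sqrt n)$ with overwhelming probability.
   Context: For a real $n\times n$ matrix $X$, $\|X\|_{op}=\sup\{\|Xu\| : u\in\mathbb{R}^n,\ \|u\|\le 1\}$, where $\|\cdot\|$ is the Euclidean norm on $\mathbb{R}^n$. An event $E$ (depending on $n$) holds with overwhelming probability if for every fixed real $k>0$ there is a constant $C_k$ independent of $n$ with $\mathbb{P}(E)\ge 1-C_k/n^k$. The assertion ''$\|M\|_{op}=O(\sqrt n)$ with overwhelming probability'' means that there is a constant $K$ independent of $n$ (depending only on $B,b$) such that the event $\{\|M\|_{op}\le K\sqrt n\}$ holds with overwhelming probability, with $C_k$ depending only on $k,B,b$. *)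

(* Defs.v *)
From mathcomp Require Import all_boot all_order all_algebra.
From mathcomp Require Import all_classical all_reals all_analysis.

Set Implicit Arguments.
Unset Strict Implicit.
Unset Printing Implicit Defensive.

Import Order.TTheory GRing.Theory Num.Theory.
Import numFieldNormedType.Exports.

Local Open Scope classical_set_scope.
Local Open Scope ring_scope.

(* MathComp-Analysis equips matrices with the max norm, hence this definition. *)
Definition euclid_norm (R : realType) (n : nat) (u : 'cV[R]_n) : R :=
  Num.sqrt (\sum_(i < n) u i ord0 ^+ 2).

Definition opnorm (R : realType) (n : nat) (X : 'M[R]_n) : R :=
  sup [set euclid_norm (X *m u) | u in [set u : 'cV[R]_n | euclid_norm u <= 1]].

(* The subfamilies are indexed by J; the sets E i with i \notin J are unused. *)
Definition mutually_independent (R : realType) (d : measure_display)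
    (T : measurableType d) (P : probability T R) (I : finType)
    (X : I -> {RV P >-> R}) : Prop :=
  forall (J : {set I}) (E : I -> set R),
    (forall i, measurable (E i)) ->
    P (\bigcap_(i in [set` J]) (X i @^-1` E i)) =
    (\prod_(i in J) P (X i @^-1` E i))%E.

Definition subgaussian (R : realType) (B b : R) (d : measure_display)
    (T : measurableType d) (P : probability T R) (X : {RV P >-> R}) : Prop :=
  forall t : R, 0 < t ->
    (P [set w | (t < `|X w|)%R] <= (B * expR (- b * t ^+ 2))%:E)%E.

(* The integrability implicit in "mean zero" follows from the tail bound. *)
Definition centered_subgaussian_entries (R : realType) (B b : R) (n : nat)
    (d : measure_display) (T : measurableType d) (P : probability T R)
    (xi : 'I_n -> 'I_n -> {RV P >-> R}) : Prop :=
  [/\ mutually_independent (fun ij : 'I_n * 'I_n => xi ij.1 ij.2),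
      forall i j, ('E_P[xi i j] = 0)%E
    & forall i j, subgaussian B b (xi i j)].

Definition random_matrix (R : realType) (n : nat) (d : measure_display)
    (T : measurableType d) (P : probability T R)
    (xi : 'I_n -> 'I_n -> {RV P >-> R}) (w : T) : 'M[R]_n :=
  \matrix_(i, j) xi i j w.

(* Main.v *)
Require Import Defs.
From mathcomp Require Import all_boot all_order all_algebra.
From mathcomp Require Import all_classical all_reals all_analysis.
From mathcomp Require Import measurable_realfun ring lra.

(* An epsilon-net argument with lattice points as the net. Rounding
   4 sqrt(n) u towards 0 coordinatewise turns a vector u of the unit ball into
   an integer vector of norm at most 4 sqrt(n), at the cost of a factor 2 in the
   operator norm; there are at most 2^(18 n) such vectors. For two of them,
   p and q, the variable n^(-1/2) <p, M q> is a combination of independent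
   centered sub-Gaussian variables with square-sum of coefficients O(n), so its
   exponential has expectation e^(O(n)). Hence Z, the sum of these exponentials
   over all pairs (p, q), also has expectation e^(O(n)), whereas Z >= e^(8 A n)
   as soon as ||M|| > A sqrt(n); conclude by Markov's inequality. *)

Import Order.TTheory GRing.Theory Num.Theory.
Import numFieldNormedType.Exports.

Local Open Scope classical_set_scope.
Local Open Scope ring_scope.

(** * Operator norm and bilinear form *)

Definition dot {R : realType} {n : nat} (u v : 'cV[R]_n) : R :=
  \sum_(i < n) u i ord0 * v i ord0.

Section LinearAlgebra.
Context {R : realType} {n : nat}.
Implicit Types (u v w : 'cV[R]_n) (X : 'M[R]_n).

Lemma dotC u v : dot u v = dot v u.
Proof. by apply: eq_bigr => i _; rewrite mulrC. Qed.

Lemma dotDl u v w : dot (u + v) w = dot u w + dot v w.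
Proof. by rewrite -big_split; apply: eq_bigr => i _; rewrite mxE mulrDl. Qed.

Lemma dotDr u v w : dot u (v + w) = dot u v + dot u w.
Proof. by rewrite !(dotC u) dotDl. Qed.

Lemma dotZl c u v : dot (c *: u) v = c * dot u v.
Proof. by rewrite mulr_sumr; apply: eq_bigr => i _; rewrite mxE mulrA. Qed.

Lemma dotZr c u v : dot u (c *: v) = c * dot u v.
Proof. by rewrite !(dotC u) dotZl. Qed.

Lemma euclid_norm_ge0 u : 0 <= euclid_norm u.
Proof. exact: sqrtr_ge0. Qed.

Lemma sqr_euclid_norm u : euclid_norm u ^+ 2 = \sum_(i < n) u i ord0 ^+ 2.
Proof. by rewrite sqr_sqrtr ?sumr_ge0// => i _; exact: sqr_ge0. Qed.

Lemma dotvv u : dot u u = euclid_norm u ^+ 2.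
Proof. by rewrite sqr_euclid_norm; apply: eq_bigr => i _; rewrite expr2. Qed.

Lemma euclid_normZ c u : euclid_norm (c *: u) = `|c| * euclid_norm u.
Proof.
apply/eqP; rewrite -(@eqrXn2 _ 2)// ?mulr_ge0 ?euclid_norm_ge0// exprMn.
by rewrite -!dotvv dotZl dotZr mulrA -expr2 real_normK ?num_real.
Qed.

(** Cauchy-Schwarz through Lagrange's identity: the double sum of the squares of [u_i v_j - u_j v_i]
    is twice the gap between the squares of the two sides. *)
Lemma dot_le u v : dot u v <= euclid_norm u * euclid_norm v.
Proof.
suff : dot u v ^+ 2 <= (euclid_norm u * euclid_norm v) ^+ 2.
  have [/ltW d0 _|d0] := ltP (dot u v) 0.
    by rewrite (le_trans d0)// mulr_ge0 ?euclid_norm_ge0.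
  by rewrite ler_pXn2r// nnegrE mulr_ge0 ?euclid_norm_ge0.
rewrite exprMn !sqr_euclid_norm.
have : 0 <= \sum_(i < n) \sum_(j < n)
    (u i ord0 * v j ord0 - u j ord0 * v i ord0) ^+ 2.
  by apply: sumr_ge0 => i _; apply: sumr_ge0 => j _; exact: sqr_ge0.
set a := \sum_(i < n) u i ord0 ^+ 2; set b := \sum_(i < n) v i ord0 ^+ 2.
suff -> : \sum_(i < n) \sum_(j < n)
    (u i ord0 * v j ord0 - u j ord0 * v i ord0) ^+ 2
    = a * b + a * b - 2 * dot u v ^+ 2 by lra.
rewrite {1}/a {1}/b {1}(mulrC a) expr2 /dot !big_distrlr/= mulr_sumr.
rewrite -big_split -sumrB; apply: eq_bigr => i _ /=.
rewrite mulr_sumr -big_split -sumrB; apply: eq_bigr => j _ /=; ring.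
Qed.

(** The Frobenius norm is a bound, by Cauchy-Schwarz on each row. Since [sup] of an unbounded set
    would be the default 0, every lower bound on [opnorm] rests on this. *)
Lemma has_ubound_opnorm X :
  has_ubound [set euclid_norm (X *m u) | u in [set u | euclid_norm u <= 1]].
Proof.
exists (Num.sqrt (\sum_(i < n) \sum_(j < n) X i j ^+ 2)) => _ [u /= u1 <-].
apply: ler_wsqrtr; apply: ler_sum => i _.
pose x : 'cV[R]_n := \col_j X i j.
have -> : (X *m u) i ord0 = dot x u.
  by rewrite mxE; apply: eq_bigr => j _; rewrite mxE.
have -> : \sum_(j < n) X i j ^+ 2 = euclid_norm x ^+ 2.
  by rewrite sqr_euclid_norm; apply: eq_bigr => j _; rewrite mxE.
rewrite -(real_normK (num_real (dot x u))) lerXn2r ?nnegrE ?euclid_norm_ge0//.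
rewrite -[leRHS]mulr1; apply: (@le_trans _ _ (euclid_norm x * euclid_norm u)).
  rewrite ler_norml dot_le andbT lerNl -mulN1r -dotZl.
  by rewrite (le_trans (dot_le _ _))// euclid_normZ normrN1 mul1r.
by rewrite ler_wpM2l ?euclid_norm_ge0.
Qed.

Lemma euclid_norm0 : euclid_norm (0 : 'cV[R]_n) = 0.
Proof. by rewrite -(scale0r (0 : 'cV[R]_n)) euclid_normZ normr0 mul0r. Qed.

Lemma euclid_norm_eq0 u : euclid_norm u = 0 -> u = 0.
Proof.
move=> u0; apply/colP => i; rewrite mxE; apply/eqP; rewrite -sqrf_eq0.
have /eqP := sqr_euclid_norm u; rewrite u0 expr0n/= eq_sym psumr_eq0.
  by move=> /allP/(_ i); rewrite mem_index_enum => /(_ isT).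
by move=> j _; exact: sqr_ge0.
Qed.

Lemma euclid_norm_mulmx X u : euclid_norm (X *m u) <= opnorm X * euclid_norm u.
Proof.
have [u0|u0] := eqVneq (euclid_norm u) 0.
  by rewrite (euclid_norm_eq0 _ u0) mulmx0 euclid_norm0 mulr0.
have ugt0 : 0 < euclid_norm u by rewrite lt_neqAle eq_sym u0 euclid_norm_ge0.
rewrite -ler_pdivrMr// mulrC -[X in X * _]gtr0_norm ?invr_gt0// -euclid_normZ.
rewrite scalemxAr; apply: ub_le_sup; first exact: has_ubound_opnorm.
exists ((euclid_norm u)^-1 *: u) => //=.
by rewrite euclid_normZ gtr0_norm ?invr_gt0// mulVf.
Qed.

Lemma opnorm_ge0 X : 0 <= opnorm X.
Proof.
apply: ub_le_sup; first exact: has_ubound_opnorm.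
by exists 0 => /=; rewrite ?mulmx0 euclid_norm0.
Qed.

Lemma dot_mulmx_le X u v : dot v (X *m u) <= opnorm X * (euclid_norm v * euclid_norm u).
Proof.
rewrite (le_trans (dot_le _ _))// mulrCA ler_wpM2l ?euclid_norm_ge0//.
exact: euclid_norm_mulmx.
Qed.

(** Duality: pairing [X *m u] with its own normalization returns its norm. When [X *m u] vanishes,
    [v = 0] still yields [0 <= K]. *)
Lemma opnorm_le_dot X K :
  (forall u v, euclid_norm u <= 1 -> euclid_norm v <= 1 -> dot v (X *m u) <= K) ->
  opnorm X <= K.
Proof.
move=> XK; apply: ge_sup => [|_ [u /= u1 <-]].
  by exists (euclid_norm (X *m 0)); exists 0 => //=; rewrite euclid_norm0.
have [x0|x0] := eqVneq (euclid_norm (X *m u)) 0.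
  by have := XK u 0 u1; rewrite x0 -(scale0r 0) dotZl mul0r scale0r euclid_norm0; apply.
have xgt0 : 0 < euclid_norm (X *m u) by rewrite lt_neqAle eq_sym x0 euclid_norm_ge0.
have := XK u ((euclid_norm (X *m u))^-1 *: (X *m u)) u1.
rewrite euclid_normZ gtr0_norm ?invr_gt0// mulVf// dotZl dotvv expr2 mulKf//.
exact.
Qed.

End LinearAlgebra.

(** * Lattice points *)

(** An integer vector coded by a sign bit and an absolute value per coordinate, which fits rounding
    towards 0. A zero coordinate has two codes, so counting codes overestimates the number of
    points. *)
Definition intpt {R : realType} {n : nat} (q : 'I_n -> bool * nat) : 'cV[R]_n :=
  \col_i ((-1) ^+ (q i).1 * (q i).2%:R).

Section Discretization.
Context {R : realType} {n : nat}.
Implicit Types (u v : 'cV[R]_n) (X : 'M[R]_n).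

Lemma ler_euclid_norm u v :
  (forall i, `|u i ord0| <= `|v i ord0|) -> euclid_norm u <= euclid_norm v.
Proof.
move=> uv; apply: ler_wsqrtr; apply: ler_sum => i _.
rewrite -(real_normK (num_real (u _ _))) -(real_normK (num_real (v _ _))).
by rewrite lerXn2r ?nnegrE.
Qed.

Lemma euclid_norm_const (c : R) :
  0 <= c -> euclid_norm (const_mx c : 'cV[R]_n) = Num.sqrt n%:R * c.
Proof.
move=> c0; rewrite /euclid_norm (eq_bigr (fun=> c ^+ 2)) => [|i _]; last by rewrite mxE.
by rewrite sumr_const card_ord -(mulr_natl (c ^+ 2)) sqrtrM// sqrtr_sqr ger0_norm.
Qed.

(** Truncating [N * |u_i|] and keeping the sign never increases an absolute value, so the rounded
    point does not leave the ball; each coordinate of [N u] moves by at most 1. *)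
Lemma round_to_intpt (N : R) u : 0 < N ->
  exists q : {ffun 'I_n -> bool * nat},
    euclid_norm (intpt q : 'cV[R]_n) <= N * euclid_norm u /\
    euclid_norm (u - N^-1 *: intpt q) <= Num.sqrt n%:R * N^-1.
Proof.
move=> N0; pose m i := Num.truncn (N * `|u i ord0|).
have mle i : (m i)%:R <= N * `|u i ord0| < (m i)%:R + 1.
  by rewrite natr1 truncn_itv// mulr_ge0// ltW.
exists [ffun i => (u i ord0 < 0, m i)]; split.
  rewrite -[X in X * _]gtr0_norm// -euclid_normZ; apply: ler_euclid_norm => i.
  rewrite !mxE ffunE/= normrM normrX normrN1 expr1n mul1r normr_nat normrM gtr0_norm//.
  by case/andP: (mle i).
rewrite -euclid_norm_const ?invr_ge0 ?(ltW N0)//; apply: ler_euclid_norm => i.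
rewrite !mxE ffunE/= {1}(realEsign (num_real (u i ord0))) mulrCA -mulrBr.
rewrite normrM normrX normrN1 expr1n mul1r [leRHS]gtr0_norm ?invr_gt0//.
rewrite -(ler_pM2l N0) -{1}(gtr0_norm N0) -normrM mulrBr mulVKf ?gt_eqF//.
rewrite divff ?gt_eqF// ler_norml; move: (mle i); set z := N * _; lra.
Qed.

(** Replacing [u] and [v] by their roundings one at a time costs two error terms, each at most
    [Num.sqrt n%:R / N] times the norm itself. For [N] above twice the root of n, the norm on the
    right can be absorbed on the left. *)
Lemma opnorm_le_intpt X (N a : R) : 0 < N ->
  (forall p q : {ffun 'I_n -> bool * nat},
    euclid_norm (intpt p : 'cV[R]_n) <= N -> euclid_norm (intpt q : 'cV[R]_n) <= N ->
    dot (intpt p) (X *m intpt q) <= a * N ^+ 2) ->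
  opnorm X <= a + 2 * (Num.sqrt n%:R / N) * opnorm X.
Proof.
move=> N0 XN; apply: opnorm_le_dot => u v u1 v1.
have [q [qN uq]] := round_to_intpt N u N0.
have [p [pN vp]] := round_to_intpt N v N0.
have {}qN : euclid_norm (intpt q : 'cV[R]_n) <= N.
  by rewrite (le_trans qN)// -[leRHS]mulr1 ler_pM2l.
have {}pN : euclid_norm (intpt p : 'cV[R]_n) <= N.
  by rewrite (le_trans pN)// -[leRHS]mulr1 ler_pM2l.
set y := N^-1 *: intpt q in uq; set z := N^-1 *: intpt p in vp.
have y1 : euclid_norm y <= 1.
  by rewrite euclid_normZ gtr0_norm ?invr_gt0// mulrC ler_pdivrMr ?mul1r.
have -> : dot v (X *m u) =
    dot z (X *m y) + dot (v - z) (X *m y) + dot v (X *m (u - y)).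
  by rewrite -dotDl (addrC z) addrNK -dotDr -mulmxDr (addrC y) addrNK.
have zy : dot z (X *m y) <= a.
  rewrite dotZl -scalemxAr dotZr mulrA -invfM mulrC ler_pdivrMr ?mulr_gt0//.
  by rewrite -expr2 XN.
rewrite -addrA lerD// -mulrA mulr_natl mulr2n; apply: lerD.
- rewrite (le_trans (dot_mulmx_le _ _ _))// [leRHS]mulrC ler_wpM2l ?opnorm_ge0//.
  by rewrite -[leRHS]mulr1 ler_pM ?euclid_norm_ge0.
- rewrite (le_trans (dot_mulmx_le _ _ _))// [leRHS]mulrC ler_wpM2l ?opnorm_ge0//.
  by rewrite -[leRHS]mul1r ler_pM ?euclid_norm_ge0.
Qed.

End Discretization.

(** Codes of the lattice points in the ball of radius [4 * Num.sqrt n%:R]. The cap [16 * n] on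
    coordinates makes the type finite and loses no point, because a natural number is at most its
    square. *)
Definition net (n : nat) : {set {ffun 'I_n -> bool * 'I_(16 * n).+1}} :=
  [set p : {ffun 'I_n -> bool * 'I_(16 * n).+1} |
    (\sum_(i < n) (p i).2 ^ 2 <= 16 * n)%N]%SET.

Definition netpt {R : realType} {n : nat}
    (p : {ffun 'I_n -> bool * 'I_(16 * n).+1}) : 'cV[R]_n :=
  intpt (fun i => ((p i).1, (p i).2 : nat)).

(* Each lattice point of the net carries weight at least [2 ^- (16 n)] under
   the product weight [\prod_i 2 ^- |p i|], whose total mass is at most [4 ^ n]. *)
Lemma card_net {R : realType} (n : nat) : #|net n|%:R <= 2 ^+ (18 * n) :> R.
Proof.
have -> : (18 * n = 16 * n + 2 * n)%N by rewrite -mulnDl.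
pose W (c : bool * 'I_(16 * n).+1) : R := 2^-1 ^+ c.2.
(* Two signs, each contributing a geometric series bounded by 2. *)
have W_sum : \sum_c W c <= 4.
  rewrite -(pair_big xpredT xpredT (fun b c => W (b, c)))/=.
  rewrite big_bool /W/=.
  have : \sum_(i < (16 * n).+1) (2^-1 : R) ^+ i <= 2.
    have := @geometric_le_lim R (16 * n).+1 1 2^-1 ler01.
    rewrite seriesEord/= invr_gt0 ger0_norm ?invr_ge0// invf_lt1// ltr1n.
    have -> : 1 / (1 - 2^-1) = 2 :> R by field.
    by under eq_bigr do rewrite mul1r; exact.
  by lra.
(* The absolute values of the coordinates add up to at most the sum of their squares, hence to at
   most [16 * n]. *)
have W_net p : p \in net n -> 1 <= 2 ^+ (16 * n) * \prod_i W (p i).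
  rewrite inE => pn; rewrite /W prodrXr exprVn -[_ ^- _]/(_^-1).
  rewrite ler_pdivlMr ?exprn_gt0// mul1r.
  rewrite ler_weXn2l ?ler1n// (leq_trans _ pn)// leq_sum// => i _.
  by case: (nat_of_ord _) => // k; rewrite -[leqLHS]muln1 leq_mul.
rewrite -sum1_card natr_sum.
apply: (@le_trans _ _ (\sum_(p in net n) 2 ^+ (16 * n) * \prod_i W (p i))).
  exact: ler_sum.
apply: (@le_trans _ _
    (\sum_(p : {ffun 'I_n -> bool * 'I_(16 * n).+1}) 2 ^+ (16 * n) * \prod_i W (p i))).
  rewrite [leRHS](bigID (mem (net n)))/= lerDl sumr_ge0// => p _.
  by rewrite mulr_ge0 ?exprn_ge0// prodr_ge0// => i _; rewrite exprn_ge0 ?invr_ge0.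
rewrite -mulr_sumr exprD ler_wpM2l ?exprn_ge0//.
rewrite -(bigA_distr_bigA (fun=> W)) prodr_const card_ord exprM -natrX.
by rewrite lerXn2r ?nnegrE// sumr_ge0// => c _; rewrite exprn_ge0 ?invr_ge0.
Qed.

Section Net.
Context {R : realType} {n : nat}.
Implicit Types X : 'M[R]_n.

Lemma sqr_euclid_norm_intpt (q : 'I_n -> bool * nat) :
  euclid_norm (intpt q : 'cV[R]_n) ^+ 2 = (\sum_(i < n) (q i).2 ^ 2)%:R.
Proof.
rewrite sqr_euclid_norm natr_sum; apply: eq_bigr => i _.
by rewrite mxE exprMn -exprM mulnC exprM sqrrN !expr1n mul1r natrX.
Qed.

Lemma netpt_norm p : p \in net n -> euclid_norm (netpt p : 'cV[R]_n) ^+ 2 <= (16 * n)%:R.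
Proof. by rewrite inE sqr_euclid_norm_intpt ler_nat. Qed.

Lemma net_intpt (q : 'I_n -> bool * nat) :
  euclid_norm (intpt q : 'cV[R]_n) <= 4 * Num.sqrt n%:R ->
  exists2 p, p \in net n & netpt p = intpt q :> 'cV[R]_n.
Proof.
move=> qN.
have {qN} qn : (\sum_(i < n) (q i).2 ^ 2 <= 16 * n)%N.
  rewrite -(@ler_nat R) -sqr_euclid_norm_intpt.
  have -> : (16 * n)%:R = (4 * Num.sqrt n%:R) ^+ 2 :> R.
    by rewrite exprMn sqr_sqrtr// natrM -natrX.
  by rewrite lerXn2r ?nnegrE ?euclid_norm_ge0// mulr_ge0 ?sqrtr_ge0.
have qi i : ((q i).2 < (16 * n).+1)%N.
  rewrite ltnS (leq_trans _ qn)// (bigD1 i)//= (leq_trans _ (leq_addr _ _))//.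
  by case: (q i).2 => // k; rewrite -[leqLHS]muln1 leq_mul.
exists [ffun i => ((q i).1, Ordinal (qi i))].
  by rewrite inE; under eq_bigr do rewrite ffunE/=.
by apply/colP => i; rewrite !mxE ffunE.
Qed.

(** Rounding at scale [N = 4 * Num.sqrt n%:R] and level [a / 2] gives a norm at most [a / 2] plus
    half of itself; the threshold is [a / 2 * N ^+ 2 = 8 * n%:R * a]. *)
Lemma opnorm_le_net X (a : R) : (0 < n)%N ->
  (forall p q, p \in net n -> q \in net n ->
    dot (netpt p) (X *m netpt q) <= 8 * n%:R * a) ->
  opnorm X <= a.
Proof.
move=> n0 Xa; have sn0 : 0 < Num.sqrt n%:R :> R by rewrite sqrtr_gt0 ltr0n.
have /(opnorm_le_intpt X (4 * Num.sqrt n%:R) (a / 2)) : 0 < 4 * Num.sqrt n%:R :> R.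
  by rewrite mulr_gt0.
have -> : Num.sqrt n%:R / (4 * Num.sqrt n%:R) = 4^-1 :> R.
  by field; rewrite gt_eqF.
suff H : forall p q : {ffun 'I_n -> bool * nat},
    euclid_norm (intpt p : 'cV[R]_n) <= 4 * Num.sqrt n%:R ->
    euclid_norm (intpt q : 'cV[R]_n) <= 4 * Num.sqrt n%:R ->
    dot (intpt p) (X *m intpt q) <= a / 2 * (4 * Num.sqrt n%:R) ^+ 2.
  by move/(_ H); lra.
move=> p q /net_intpt[p' p'n <-] /net_intpt[q' q'n <-].
rewrite (le_trans (Xa _ _ p'n q'n))// exprMn sqr_sqrtr//; lra.
Qed.

(* A countable union of conditions: this is what makes [opnorm] measurable. *)
Lemma opnorm_gt_intpt X (a : R) : 0 <= a ->
  a < opnorm X <-> exists pq : {ffun 'I_n -> bool * nat} * {ffun 'I_n -> bool * nat},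
    a * (euclid_norm (intpt pq.1 : 'cV[R]_n) * euclid_norm (intpt pq.2 : 'cV[R]_n))
      < dot (intpt pq.1) (X *m intpt pq.2).
Proof.
move=> a0; split=> [aX|[[p q]/=]]; last first.
  apply: contraTT; rewrite -!leNgt => Xa.
  rewrite (le_trans (dot_mulmx_le _ _ _))// ler_wpM2r// mulr_ge0//;
    exact: euclid_norm_ge0.
apply: contrapT => /forallNP aP.
(* At this scale, with [s] the root of n, the rounding error is [s / (s + 1)] times the gap
   [opnorm X - a], hence strictly smaller than the gap. The [+ 1] provides the strictness. *)
pose N : R := 2 * (Num.sqrt n%:R + 1) * opnorm X / (opnorm X - a).
have X0 : 0 < opnorm X by exact: le_lt_trans aX.
have s0 := sqrtr_ge0 (n%:R : R).
have N0 : 0 < N by rewrite divr_gt0 ?subr_gt0// !mulr_gt0 ?ltr_wpDl.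
suff /(opnorm_le_intpt X N a N0) : forall p q : {ffun 'I_n -> bool * nat},
    euclid_norm (intpt p : 'cV[R]_n) <= N ->
    euclid_norm (intpt q : 'cV[R]_n) <= N ->
    dot (intpt p) (X *m intpt q) <= a * N ^+ 2.
  rewrite leNgt => /negP; apply; rewrite -ltrBrDl.
  rewrite /N; set s := Num.sqrt _ in s0 *.
  have -> : 2 * (s / (2 * (s + 1) * opnorm X / (opnorm X - a))) * opnorm X
      = s / (s + 1) * (opnorm X - a).
    by field; rewrite !gt_eqF ?subr_gt0// ltr_wpDl.
  rewrite gtr_pMl ?subr_gt0// ltr_pdivrMr; lra.
move=> p q pN qN; have /negP := aP (p, q); rewrite -leNgt => /le_trans; apply.
by rewrite ler_wpM2l// expr2 ler_pM ?euclid_norm_ge0.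
Qed.

End Net.

(** * Sub-Gaussian moments *)

(** From [expR y - 1 <= y * expR y] it remains to bound [y * (expR y - 1)]: reuse the same
    inequality if [y >= 0], and [expR y - 1 >= y] if [y < 0]. *)
Lemma expR_le_quad {R : realType} (y : R) : expR y <= 1 + y + y ^+ 2 * expR `|y|.
Proof.
have ey : expR y - 1 <= y * expR y.
  have := expR_ge1Dx (- y); rewrite expRN => h.
  have := ler_wpM2r (expR_ge0 y) h.
  rewrite mulVf ?gt_eqF ?expR_gt0//; lra.
have [y0|y0] := leP 0 y.
  have := ler_wpM2l y0 ey; rewrite ger0_norm//; lra.
have := expR_ge1Dx y; have := expR_ge1Dx `|y|; rewrite ltr0_norm// => h1 h2.
have : y * (expR y - 1) <= y ^+ 2 by rewrite expr2 ler_wnM2l ?(ltW y0)//; lra.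
have : y ^+ 2 * 1 <= y ^+ 2 * expR (- y) by rewrite ler_wpM2l ?sqr_ge0//; lra.
lra.
Qed.

(** Split [expR (s * x ^+ 2)] into two equal factors: one absorbs the [x ^+ 2] of the quadratic
    remainder, the other absorbs [expR |l * x|] by the arithmetic-geometric mean inequality. *)
Lemma expRM_le_quad {R : realType} (s l x : R) : 0 < s ->
  expR (l * x) <= 1 + l * x +
    l ^+ 2 * (2 / s) * expR (l ^+ 2 / (2 * s)) * expR (s * x ^+ 2).
Proof.
move=> s0; apply: (le_trans (expR_le_quad _)); rewrite lerD2l exprMn.
have x2 : x ^+ 2 <= 2 / s * expR (s / 2 * x ^+ 2).
  have := expR_ge1Dx (s / 2 * x ^+ 2); set E := expR _ => h.
  rewrite -(ler_pM2l (_ : 0 < s / 2)) ?divr_gt0//.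
  have -> : s / 2 * (2 / s * E) = E by field; rewrite gt_eqF.
  lra.
have lx : `|l * x| <= l ^+ 2 / (2 * s) + s / 2 * x ^+ 2.
  have -> : l ^+ 2 / (2 * s) + s / 2 * x ^+ 2 = (l ^+ 2 + (s * x) ^+ 2) / (2 * s).
    by field; rewrite gt_eqF.
  rewrite ler_pdivlMr ?mulr_gt0// -[2 * s]gtr0_norm ?mulr_gt0// -normrM.
  rewrite ler_norml; have := sqr_ge0 (l - s * x); have := sqr_ge0 (l + s * x).
  lra.
set E := expR (l ^+ 2 / (2 * s)); set F := expR (s / 2 * x ^+ 2) in x2.
have -> : expR (s * x ^+ 2) = F * F.
  by rewrite -expRD; congr expR; field.
have -> : l ^+ 2 * (2 / s) * E * (F * F) = l ^+ 2 * (2 / s * F * (E * F)) by ring.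
rewrite -[leLHS]mulrA ler_wpM2l ?sqr_ge0// ler_pM ?sqr_ge0 ?expR_ge0//.
by rewrite -expRD ler_expR.
Qed.

(* Truncating by [min] turns this dyadic layer-cake bound into a one-step induction. *)
Lemma minr_dyadic_le {R : realType} (y : R) m :
  Num.min y (2 ^+ m.+1) <= 2 + \sum_(k < m) 2 ^+ k.+1 * (2 ^+ k.+1 < y)%R%:R.
Proof.
elim: m => [|m IH]; first by rewrite big_ord0 addr0 expr1 ge_min lexx orbT.
rewrite big_ord_recr/= addrA (le_trans _ (lerD IH (lexx _)))// [in leLHS]exprS.
have := exprn_gt0 m.+1 (ltr0n R 2); set M := 2 ^+ m.+1 => M0.
case: (leP y M) => yM; case: (leP y (2 * M)) => yM2; rewrite ?mulr1 ?mulr0; lra.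
Qed.

(** With [s = b / 2], the summands are [2 / s * (2 + B)], from the quadratic remainder, and
    [1 / (2 * s)], from its exponential prefactor. *)
Definition mgf_rate {R : realType} (B b : R) : R := 4 * (2 + B) / b + 1 / b.

Lemma mgf_rate_gt0 {R : realType} (B b : R) : 0 < B -> 0 < b -> 0 < mgf_rate B b.
Proof. by move=> B0 b0; rewrite addr_gt0 ?divr_gt0// mulr_gt0// addr_gt0. Qed.

Section SubGaussian.
Context {R : realType} {d : measure_display} {T : measurableType d}
  {P : probability T R}.
Implicit Types X : {RV P >-> R}.

(** Dyadic layer cake. The exponent is half the tail rate, so [Y] exceeds [2 ^+ k.+1] with
    probability at most [B] times the inverse square of that level; level [k] then contributes at
    most [B / 2 ^+ k.+1], and the levels sum to at most [B]. *)
Lemma subgaussian_expR_sqr (B b : R) X : 0 < B -> 0 < b -> subgaussian B b X ->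
  (\int[P]_w (expR (b / 2 * X w ^+ 2))%:E <= (2 + B)%:E)%E.
Proof.
move=> B0 b0 XB; pose Y w := expR (b / 2 * X w ^+ 2).
have mY : measurable_fun setT Y.
  apply: measurableT_comp => //; apply: measurable_funM => //.
  exact: measurable_funX.
pose A k := [set w | 2 ^+ k.+1 < Y w].
have mA k : measurable (A k).
  have := mY measurableT `]2 ^+ k.+1, +oo[%classic (measurable_itv _).
  rewrite setTI; congr measurable; apply/seteqP; split => w /=; by rewrite in_itv/= andbT.
pose f k w : \bar R := (2 ^+ k.+1 * \1_(A k) w)%:E.
have mf k : measurable_fun setT (f k).
  by apply/measurable_EFinP; apply: measurable_funM => //; exact: measurable_indic.
have f0 k w : (0 <= f k w)%E by rewrite lee_fin mulr_ge0 ?exprn_ge0.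
have AE k w : \1_(A k) w = (2 ^+ k.+1 < Y w)%R%:R :> R.
  by rewrite indicE; congr ((nat_of_bool _)%:R); apply/idP/idP => /[!inE].
have Yle w : ((Y w)%:E <= 2%:E + \sum_(0 <= k <oo) f k w)%E.
  have [m Ym] : exists m, Y w <= 2 ^+ m.+1.
    exists (Num.truncn (Y w)); rewrite (le_trans (ltW (truncnS_gt _)))//.
    by rewrite -natrX ler_nat ltnW// ltn_expl.
  have fm : (\sum_(0 <= k < m) f k w <= \sum_(0 <= k <oo) f k w)%E.
    exact: nneseries_lim_ge.
  apply: (le_trans _ (leeD2l 2%:E fm)).
  rewrite sumEFin -EFinD lee_fin big_mkord -{1}(min_idPl Ym).
  by under eq_bigr do rewrite AE; exact: minr_dyadic_le.
have Pf k : (\int[P]_w f k w <= (B / 2 ^+ k.+1)%:E)%E.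
  under eq_integral do rewrite /f EFinM.
  rewrite ge0_integralZl//; last by apply/measurable_EFinP; exact: measurable_indic.
  rewrite integral_indic// setIT.
  pose t := Num.sqrt (k.+1%:R * ln 2 * (2 / b)).
  have ln2 : 0 < ln 2 :> R by rewrite ln_gt0// ltr1n.
  have t2 : b / 2 * t ^+ 2 = k.+1%:R * ln 2.
    rewrite sqr_sqrtr; last by rewrite ltW// !mulr_gt0// invr_gt0.
    by field; rewrite gt_eqF.
  have t0 : 0 < t by rewrite sqrtr_gt0 !mulr_gt0// invr_gt0.
  have E2 : 2 ^+ k.+1 = expR (b / 2 * t ^+ 2) by rewrite t2 expRM_natl lnK// posrE.
  have -> : A k = [set w | t < `|X w|].
    have At w : (2 ^+ k.+1 < Y w) = (t < `|X w|).
      rewrite E2 ltr_expR ltr_pM2l ?divr_gt0// -(real_normK (num_real (X w))).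
      by rewrite ltr_pXn2r ?nnegrE// ltW.
    by apply/seteqP; split => w; rewrite /A /mkset At.
  apply: (@le_trans _ _ ((2 ^+ k.+1)%:E * (B * expR (- b * t ^+ 2))%:E)%E).
    by rewrite lee_pmul2l// ?lte_fin ?exprn_gt0//; exact: XB.
  rewrite -EFinM lee_fin.
  have -> : - b * t ^+ 2 = - (b / 2 * t ^+ 2) - (b / 2 * t ^+ 2) by field.
  by rewrite expRD !expRN -E2; set e := 2 ^+ _; rewrite mulrCA mulVKf ?gt_eqF ?exprn_gt0.
apply: (@le_trans _ _ (\int[P]_w (2%:E + \sum_(0 <= k <oo) f k w))%E).
  apply: (@ge0_le_integral _ _ _ P setT measurableT (EFin \o Y)).
  - by move=> w _; rewrite lee_fin expR_ge0.
  - exact/measurable_EFinP.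
  - apply: emeasurable_funD => //.
    exact: ge0_emeasurable_sum.
  - by move=> w _; exact: Yle.
rewrite ge0_integralD//; last 2 first.
  - by move=> w _; exact: nneseries_ge0.
  - exact: ge0_emeasurable_sum.
rewrite integral_cst// [X in (2%:E * X + _)%E]probability_setT mule1 (EFinD 2 B) leeD2l//.
rewrite integral_nneseries//.
apply: lime_le.
  by apply: is_cvg_nneseries => k _ _; exact: integral_ge0.
near=> n.
apply: (@le_trans _ _ (\sum_(0 <= k < n) (B / 2 ^+ k.+1)%:E)%E).
  exact: lee_sum.
rewrite sumEFin lee_fin -mulr_sumr big_mkord ger_pMr//.
have := @geometric_le_lim R n 2^-1 2^-1.
rewrite seriesEord/= invr_ge0 invr_gt0 ger0_norm ?invr_ge0// invf_lt1// ltr1n.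
have -> : 2^-1 / (1 - 2^-1) = 1 :> R by field.
move=> /(_ (ler0n _ _) (ltr0Sn _ _) isT); apply: le_trans; apply: ler_sum => i _.
by rewrite exprVn -invfM -exprS.
Unshelve. all: by end_near.
Qed.

(* [expRM_le_quad] with [s := b / 2] controls the exponential by one of the square,
   and the mean-zero hypothesis kills its linear term. *)
Lemma subgaussian_mgf (B b l : R) X : 0 < B -> 0 < b -> subgaussian B b X ->
  ('E_P[X] = 0)%E ->
  (\int[P]_w (expR (l * X w))%:E <= (expR (mgf_rate B b * l ^+ 2))%:E)%E.
Proof.
move=> B0 b0 XB EX; set s := b / 2.
have s0 : 0 < s by rewrite divr_gt0.
pose Y w := expR (s * X w ^+ 2).
have mY : measurable_fun setT Y.
  apply: measurableT_comp => //; apply: measurable_funM => //.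
  exact: measurable_funX.
have EY := subgaussian_expR_sqr _ _ _ B0 b0 XB.
have iY : P.-integrable setT (EFin \o Y).
  apply/integrableP; split; first exact/measurable_EFinP.
  under eq_integral do rewrite /= ger0_norm ?expR_ge0//.
  by rewrite (le_lt_trans EY)// ltry.
(* Domination: [|x| <= 1 + x ^+ 2], where [1 <= Y] and [x ^+ 2 <= s^-1 * Y]. *)
have iX : P.-integrable setT (EFin \o X).
  have : P.-integrable setT (fun w => ((1 + s^-1))%:E * (EFin \o Y) w)%E.
    exact: integrableZl.
  apply: le_integrable => //; first exact/measurable_EFinP.
  move=> w _ /=; rewrite lee_fin [leRHS]ger0_norm; last first.
    by rewrite mulr_ge0 ?expR_ge0// addr_ge0// invr_ge0 ltW.
  have := ler_wpM2l (ltW (_ : 0 < s^-1)) (expR_ge1Dx (s * X w ^+ 2)).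
  rewrite -/(Y w) invr_gt0 mulrDr mulr1 mulKf ?gt_eqF// => /(_ s0) sY.
  have Y1 : 1 <= Y w by rewrite -expR0 ler_expR mulr_ge0 ?sqr_ge0// ltW.
  have s'0 : 0 < s^-1 by rewrite invr_gt0.
  have : `|X w| <= 1 + X w ^+ 2.
    by rewrite ler_norml; have := sqr_ge0 (X w - 1); have := sqr_ge0 (X w + 1); lra.
  lra.
set D := l ^+ 2 * (2 / s) * expR (l ^+ 2 / (2 * s)).
have D0 : 0 <= D by rewrite mulr_ge0 ?expR_ge0// mulr_ge0 ?sqr_ge0// divr_ge0// ltW.
have i1 : P.-integrable setT (cst 1%:E) by exact: finite_measure_integrable_cst.
have ilX : P.-integrable setT (fun w => l%:E * (X w)%:E)%E by exact: integrableZl.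
have iLX : P.-integrable setT (fun w => (1 + l * X w)%:E).
  exact: (integrableD measurableT i1 ilX).
have iDY : P.-integrable setT (fun w => D%:E * (Y w)%:E)%E by exact: integrableZl.
apply: (@le_trans _ _ (\int[P]_w ((1 + l * X w)%:E + D%:E * (Y w)%:E))%E).
  apply: (@ge0_le_integral _ _ _ P setT measurableT (fun w => (expR (l * X w))%:E)).
  - by move=> w _; rewrite lee_fin expR_ge0.
  - apply/measurable_EFinP; apply: measurableT_comp => //; exact: measurable_funM.
  - by apply: emeasurable_funD; [exact: measurable_int iLX|exact: measurable_int iDY].
  - by move=> w _; rewrite -EFinM -EFinD lee_fin; exact: expRM_le_quad.
rewrite integralD// integralZl//.
under eq_integral do rewrite EFinD EFinM.
rewrite integralD// integral_cst// [X in (1%:E * X + _)%E]probability_setT.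
rewrite mule1 integralZl//.
move: EX; rewrite unlock => ->; rewrite mule0 adde0.
apply: (@le_trans _ _ (1 + D%:E * (2 + B)%:E)%E).
  by rewrite leeD2l// lee_wpmul2l// lee_fin.
rewrite -EFinM -EFinD lee_fin.
have -> : mgf_rate B b * l ^+ 2
    = l ^+ 2 * (2 / s) * (2 + B) + l ^+ 2 / (2 * s).
  by rewrite /mgf_rate /s; field; rewrite gt_eqF.
rewrite expRD /D.
have := expR_ge1Dx (l ^+ 2 * (2 / s) * (2 + B)).
set x := l ^+ 2 * (2 / s) * (2 + B) => x1.
(* Writing [e] for this factor, [1 + x * e <= (1 + x) * e <= expR x * e]. *)
have y1 : 1 <= expR (l ^+ 2 / (2 * s)).
  by rewrite -expR0 ler_expR divr_ge0 ?sqr_ge0// mulr_ge0// ltW.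
have := ler_wpM2r (le_trans ler01 y1) x1.
by rewrite mulrDl mul1r; apply: le_trans; rewrite lerD// /x mulrAC.
Qed.

End SubGaussian.

(** * Products of independent variables *)

Section Independence.
Import HBNNSimple.
Context {R : realType} {d : measure_display} {T : measurableType d}
  {P : probability T R}.

Lemma measurable_preimage_rv (X : {RV P >-> R}) (E : set R) :
  measurable E -> measurable (X @^-1` E).
Proof. by move=> mE; rewrite -[X in measurable X]setTI; exact: measurable_funP. Qed.

Lemma integral_sum_indic (J : finType) (a : J -> R) (A : J -> set T) :
  (forall j, 0 <= a j) -> (forall j, measurable (A j)) ->
  (\int[P]_w (\sum_j a j * \1_(A j) w)%:E = (\sum_j a j * fine (P (A j)))%:E)%E.
Proof.
move=> a0 mA; under eq_integral do rewrite -sumEFin.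
have mI j : measurable_fun setT (fun w => (\1_(A j) w)%:E : \bar R).
  by apply/measurable_EFinP; exact: measurable_indic.
rewrite ge0_integral_sum//; last 2 first.
- by move=> j; under eq_fun do rewrite EFinM; exact: measurable_funeM.
- by move=> j w _; rewrite lee_fin mulr_ge0.
rewrite -sumEFin; apply: eq_bigr => j _.
under eq_integral do rewrite EFinM.
rewrite ge0_integralZl//; last by rewrite lee_fin.
by rewrite integral_indic// setIT EFinM fineK// fin_num_measure.
Qed.

Context {I : finType} {X : I -> {RV P >-> R}}.
Context (indepX : mutually_independent X).

(** Each factor is a combination of indicators of its level sets. Distributing the product over the
    sums yields one term per choice [phi] of values, and independence factors the probability of
    each intersection of level sets. *)
Lemma integral_prod_finite_range (f : I -> R -> R) (V : seq R) :
  (forall i, measurable_fun setT (f i)) -> uniq V -> (forall y, y \in V -> 0 <= y) ->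
  (forall i x, f i x \in V) ->
  (\int[P]_w (\prod_i f i (X i w))%:E = \prod_i \int[P]_w (f i (X i w))%:E)%E.
Proof.
move=> mf uV V0 fV; pose m := size V; pose c (k : 'I_m) := V`_k.
have c0 k : 0 <= c k by apply/V0/mem_nth.
pose E i (k : 'I_m) := f i @^-1` [set c k].
have mE i k : measurable (E i k) by rewrite -[E i k]setTI; exact: mf.
have mXE i k : measurable (X i @^-1` E i k) by exact: measurable_preimage_rv.
have fE i w : f i (X i w) = \sum_k c k * \1_(X i @^-1` E i k) w.
  have h : (index (f i (X i w)) V < m)%N by rewrite index_mem.
  rewrite (bigD1 (Ordinal h))//= big1 ?addr0 => [|k kh].
    by rewrite indicE mem_set ?mulr1 /c ?nth_index//= /E/=/c/= nth_index.
  rewrite indicE memNset ?mulr0//= => /esym fk.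
  move/eqP: kh; apply; apply: val_inj => /=.
  by rewrite -fk index_uniq.
pose p i k := fine (P (X i @^-1` E i k)).
have -> : (\prod_i \int[P]_w (f i (X i w))%:E = (\prod_i \sum_k c k * p i k)%:E)%E.
  rewrite -prodEFin; apply: eq_bigr => i _.
  under eq_integral do rewrite fE.
  exact: integral_sum_indic.
pose A (phi : {ffun I -> 'I_m}) :=
  \bigcap_(i in [set` [set: I]%SET]) (X i @^-1` E i (phi i)).
have mA phi : measurable (A phi).
  by apply: fin_bigcap_measurable => // i _.
have -> : (\int[P]_w (\prod_i f i (X i w))%:E =
    \int[P]_w (\sum_(phi : {ffun I -> 'I_m}) (\prod_i c (phi i)) * \1_(A phi) w)%:E)%E.
  apply: eq_integral => w _; congr EFin.
  under eq_bigr do rewrite fE.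
  rewrite bigA_distr_bigA; apply: eq_bigr => phi _.
  rewrite big_split; congr (_ * _)%R => /=.
  have [wA|wA] := pselect (A phi w).
    rewrite [RHS]indicE mem_set// big1// => i _.
    by rewrite indicE mem_set//; apply: wA; rewrite /= inE.
  rewrite [RHS]indicE memNset//; move/existsNP : wA => [i /not_implyP[_ wi]].
  by rewrite (bigD1 i)//= indicE memNset// mul0r.
rewrite integral_sum_indic//; last by move=> phi; rewrite prodr_ge0.
rewrite bigA_distr_bigA; congr EFin; apply: eq_bigr => phi _.
rewrite big_split; congr (_ * _)%R => /=.
rewrite /A indepX//.
apply: EFin_inj; rewrite -prodEFin fineK; last first.
  by rewrite -indepX// fin_num_measure// ; exact: mA.
apply: eq_big => [i|i _]; first by rewrite inE.
by rewrite fineK// fin_num_measure.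
Qed.

(* Only an inequality is stated: it survives the monotone limit even when some
   factors are [+oo] and others [0]. *)
Lemma integral_prod_le (f : I -> R -> R) :
  (forall i, measurable_fun setT (f i)) -> (forall i x, 0 <= f i x) ->
  (\int[P]_w (\prod_i f i (X i w))%:E <= \prod_i \int[P]_w (f i (X i w))%:E)%E.
Proof.
move=> mf f0.
have mF i : measurable_fun setT (EFin \o f i) by exact/measurable_EFinP.
(* Increasing simple approximations: the finite-range case applies at each stage, and monotone
   convergence passes to the limit on the left-hand side. *)
pose s i n : {nnsfun R >-> R} := nnsfun_approx measurableT (mF i) n.
have s_cvg i x : s i n x @[n --> \oo] --> f i x.
  have Fi0 : forall y, setT y -> (0 <= (EFin \o f i) y)%E by move=> y _; rewrite lee_fin.
  have h : (s i n x)%:E @[n --> \oo] --> (f i x)%:E.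
    exact: (cvg_nnsfun_approx measurableT (mF i) Fi0).
  exact: (fine_cvg h).
have s_nd i x : {homo (fun n => s i n x) : m n / (m <= n)%N >-> m <= n}.
  by move=> m n mn; have /lefP := nd_nnsfun_approx measurableT (mF i) mn; apply.
have s_le i n x : s i n x <= f i x.
  rewrite -(cvg_lim _ (s_cvg i x))//; apply: nondecreasing_cvgn_le => //.
  by apply/cvg_ex; exists (f i x).
have ms i n : measurable_fun setT (fun w => s i n (X i w)).
  exact: measurableT_comp.
have mprod n : measurable_fun setT (fun w => (\prod_i s i n (X i w))%:E).
  by apply/measurable_EFinP; apply: measurable_prod.
have <- : (\int[P]_w limn (fun n => (\prod_i s i n (X i w))%:E) =
    \int[P]_w (\prod_i f i (X i w))%:E)%E.
  apply: eq_integral => w _; apply/cvg_lim => //.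
  apply: cvg_EFin; first by near=> n.
  rewrite /comp/=; elim: (index_enum I) => [|i r IH].
    by under eq_fun do rewrite big_nil; rewrite big_nil; exact: cvg_cst.
  by under eq_fun do rewrite big_cons; rewrite big_cons; exact: cvgM.
rewrite monotone_convergence//; last 2 first.
- by move=> n w _; rewrite lee_fin prodr_ge0.
- move=> w _ m n mn; rewrite lee_fin; apply: ler_prod => i _.
  by rewrite s_nd// andbT.
apply: lime_le.
  apply: ereal_nondecreasing_is_cvgn => m n mn.
  apply: ge0_le_integral => //.
  - by move=> w _; rewrite lee_fin prodr_ge0.
  - move=> w _; rewrite lee_fin; apply: ler_prod => i _.
    by rewrite s_nd// andbT.
near=> n.
have /choice[r rE] : forall i, exists r : seq R, range (s i n) = [set` r].
  by move=> i; apply/finite_seqP.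
(* One duplicate-free list of nonnegative values containing the ranges of all factors. *)
pose V := undup [seq y <- flatten [seq r i | i <- enum I] | 0 <= y].
rewrite (integral_prod_finite_range (fun i => s i n) V)//.
(* Multiplying inequalities of extended reals needs nonnegativity, so the induction carries it
   along. *)
- pose le0 (a b : \bar R) := (0 <= a)%E /\ (a <= b)%E.
  suff [] : le0 (\prod_i \int[P]_w (s i n (X i w))%:E)%E
                (\prod_i \int[P]_w (f i (X i w))%:E)%E by [].
  apply: (big_ind2 le0) => [|x1 x2 y1 y2 [? ?] [? ?]|i _].
  + by split.
  + by split; [exact: mule_ge0|exact: lee_pmul].
  + split; first by apply: integral_ge0 => w _; rewrite lee_fin.
    apply: ge0_le_integral => //.
    * by move=> w _; rewrite lee_fin.
    * exact/measurable_EFinP.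
    * by apply/measurable_EFinP; exact: measurableT_comp.
    * by move=> w _; rewrite lee_fin.
- exact: undup_uniq.
- by move=> y; rewrite mem_undup mem_filter => /andP[].
- move=> i x; rewrite mem_undup mem_filter; apply/andP; split => //.
  apply/flattenP; exists (r i); first by apply/mapP; exists i => //; rewrite mem_enum.
  by have : range (s i n) (s i n x) by []; rewrite rE.
Unshelve. all: by end_near.
Qed.

End Independence.

(** * The random matrix *)

Section OpnormTail.
Context {R : realType} {B b : R} {n : nat} {d : measure_display} {T : measurableType d}
  {P : probability T R} {xi : 'I_n -> 'I_n -> {RV P >-> R}}.

Lemma dot_random_matrix (p q : 'cV[R]_n) w :
  dot p (random_matrix xi w *m q) =
  \sum_(ij : 'I_n * 'I_n) p ij.1 ord0 * q ij.2 ord0 * xi ij.1 ij.2 w.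
Proof.
rewrite -(pair_bigA _ (fun i j => p i ord0 * q j ord0 * xi i j w))/=.
apply: eq_bigr => i _; rewrite mxE mulr_sumr; apply: eq_bigr => j _.
by rewrite mxE; ring.
Qed.

Lemma measurable_dot_random_matrix (p q : 'cV[R]_n) :
  measurable_fun setT (fun w => dot p (random_matrix xi w *m q)).
Proof.
under eq_fun do rewrite dot_random_matrix.
by apply: measurable_sum => ij; exact: measurable_funM.
Qed.

Lemma measurable_opnorm_gt (a : R) : 0 <= a ->
  measurable [set w | a < opnorm (random_matrix xi w)].
Proof.
move=> a0; pose F (pq : {ffun 'I_n -> bool * nat} * {ffun 'I_n -> bool * nat}) :=
  [set w | a * (euclid_norm (intpt pq.1 : 'cV[R]_n) * euclid_norm (intpt pq.2 : 'cV[R]_n))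
    < dot (intpt pq.1) (random_matrix xi w *m intpt pq.2)].
have -> : [set w | a < opnorm (random_matrix xi w)] = \bigcup_pq F pq.
  apply/seteqP; split => w /=.
    by move/(opnorm_gt_intpt _ _ a0) => [pq ?]; exists pq.
  by move=> [pq _ ?]; apply/(opnorm_gt_intpt _ _ a0); exists pq.
apply: countable_bigcupT_measurable => [|pq]; first exact: countableP.
have := measurable_dot_random_matrix (intpt pq.1) (intpt pq.2) measurableT _
  (measurable_itv `]a * (euclid_norm (intpt pq.1 : 'cV[R]_n) *
    euclid_norm (intpt pq.2 : 'cV[R]_n)), +oo[).
by rewrite setTI; congr measurable; apply/seteqP; split => w /=; rewrite in_itv/= andbT.
Qed.

Context (B0 : 0 < B) (b0 : 0 < b) (xiP : centered_subgaussian_entries B b xi).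
Local Notation kappa := (mgf_rate B b).

(** The exponential is a product over entries with coefficients [t * p_i * q_j], whose squares sum
    to the square of [t] times both norms. *)
Lemma dot_random_matrix_mgf (p q : 'cV[R]_n) t :
  (\int[P]_w (expR (t * dot p (random_matrix xi w *m q)))%:E
   <= (expR (kappa * (t * (euclid_norm p * euclid_norm q)) ^+ 2))%:E)%E.
Proof.
have [indep mean0 tails] := xiP.
pose f (ij : 'I_n * 'I_n) x := expR (t * (p ij.1 ord0 * q ij.2 ord0) * x).
under eq_integral do rewrite dot_random_matrix mulr_sumr expR_sum.
under eq_integral => w _.
  under eq_bigr => ij _ do rewrite mulrA -/(f ij (xi ij.1 ij.2 w)).
  over.
have mf ij : measurable_fun setT (f ij).
  by apply: measurableT_comp => //; exact: mulrl_measurable.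
apply: (le_trans (integral_prod_le indep f mf (fun _ _ => expR_ge0 _))).
rewrite !exprMn !sqr_euclid_norm big_distrlr/= pair_bigA/= mulrA mulr_sumr expR_sum.
rewrite -prodEFin.
pose le0 (x y : \bar R) := (0 <= x)%E /\ (x <= y)%E.
apply: (proj2 (_ : le0 _ _)); apply: (big_ind2 le0) => [|x1 x2 y1 y2 [? ?] [? ?]|ij _].
- by split.
- by split; [exact: mule_ge0|exact: lee_pmul].
- split; first by apply: integral_ge0 => w _; rewrite lee_fin expR_ge0.
  have := subgaussian_mgf _ _ (t * (p ij.1 ord0 * q ij.2 ord0)) _ B0 b0
    (tails ij.1 ij.2) (mean0 ij.1 ij.2).
  by rewrite !exprMn (mulrA kappa).
Qed.

Lemma opnorm_tail (A : R) : (0 < n)%N -> 0 <= A ->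
  (P [set w | (A * Num.sqrt n%:R < opnorm (random_matrix xi w))%R]
    <= (expR ((36 + 256 * kappa - 8 * A) * n%:R))%:E)%E.
Proof.
move=> n0 A0; set E := [set w | _].
have nR0 : 0 < n%:R :> R by rewrite ltr0n.
have sn0 : 0 < Num.sqrt n%:R :> R by rewrite sqrtr_gt0.
have sn2 : Num.sqrt n%:R ^+ 2 = n%:R :> R by rewrite sqr_sqrtr.
have k0 : 0 < kappa by exact: mgf_rate_gt0.
have mE : measurable E by apply: measurable_opnorm_gt; rewrite mulr_ge0// ltW.
(* This scale makes every exponent linear in n: a net pair has moment exponent at most
   [kappa * (16 n)^2 / n = 256 * kappa * n], the two nets add [18 n] each, and a pair above the
   threshold [8 * n * A * sqrt n] contributes [8 * A * n]. *)
pose t : R := (Num.sqrt n%:R)^-1.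
pose z p q w := expR (t * dot (netpt p) (random_matrix xi w *m netpt q)).
have mz p q : measurable_fun setT (fun w => (z p q w)%:E).
  apply/measurable_EFinP; apply: measurableT_comp => //.
  by apply: measurable_funM => //; exact: measurable_dot_random_matrix.
have z0 p q w : (0 <= (z p q w)%:E)%E by rewrite lee_fin expR_ge0.
pose N := enum (net n).
pose Z w := (\sum_(p <- N) \sum_(q <- N) (z p q w)%:E)%E.
have mZp p : measurable_fun setT (fun w => \sum_(q <- N) (z p q w)%:E)%E.
  by apply: emeasurable_sum => q.
have Zp0 p w : (0 <= \sum_(q <- N) (z p q w)%:E)%E by apply: sume_ge0.
have N_size : (size N)%:R <= expR (18 * n%:R) :> R.
  rewrite -cardE (le_trans (card_net n))//.
  rewrite -(natrM _ 18 n) -[X in expR X]mulr1 expRM_natl lerXn2r ?nnegrE ?expR_ge0//.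
  exact: (expR_ge1Dx 1).
have Zle : (\int[P]_w Z w <= (expR ((36 + 256 * kappa) * n%:R))%:E)%E.
  rewrite ge0_integral_sum//.
  apply: (@le_trans _ _ (\sum_(p <- N) \sum_(q <- N) (expR (256 * kappa * n%:R))%:E)%E).
    rewrite big_seq [leRHS]big_seq; apply: lee_sum => p; rewrite mem_enum => pn.
    rewrite ge0_integral_sum//.
    rewrite big_seq [leRHS]big_seq; apply: lee_sum => q; rewrite mem_enum => qn.
    apply: (le_trans (dot_random_matrix_mgf _ _ _)); rewrite lee_fin ler_expR.
    have := ler_pM (sqr_ge0 _) (sqr_ge0 _) (netpt_norm (R := R) _ pn) (netpt_norm _ qn).
    set x := euclid_norm _ ^+ 2 * _ => xle.
    rewrite !exprMn -/x exprVn sn2 (mulrC 256) -mulrA ler_pM2l//.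
    by rewrite mulrC ler_pdivrMr// (le_trans xle)// natrM; lra.
  under eq_bigr do rewrite sumEFin big_const_seq count_predT iter_addr_0.
  rewrite sumEFin big_const_seq count_predT iter_addr_0 lee_fin.
  have -> : (36 + 256 * kappa) * n%:R =
      18 * n%:R + 18 * n%:R + 256 * kappa * n%:R by ring.
  rewrite -mulrnA -(mulr_natl (expR _)) natrM !expRD ler_pM2r ?expR_gt0//.
  by rewrite ler_pM.
(* Markov's inequality: on [E] some net pair exceeds the threshold of [opnorm_le_net], and its
   single nonnegative term already bounds [Z] from below. *)
have EZ : ((expR (8 * A * n%:R))%:E * P E <= \int[P]_w Z w)%E.
  have mI : measurable_fun setT (fun w => (\1_E w)%:E : \bar R).
    by apply/measurable_EFinP; exact: measurable_indic.
  have -> : ((expR (8 * A * n%:R))%:E * P E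
      = \int[P]_w ((expR (8 * A * n%:R))%:E * (\1_E w)%:E))%E.
    by rewrite ge0_integralZl ?integral_indic ?setIT ?lee_fin ?expR_ge0.
  apply: ge0_le_integral => //.
  - exact: measurable_funeM.
  - by apply: emeasurable_sum.
  move=> w _; rewrite -EFinM indicE.
  have [Ew|Ew] := pselect (E w); last first.
    by rewrite memNset// mulr0; apply: sume_ge0.
  rewrite mem_set// mulr1.
  have [p [q [pn qn pq]]] : exists p q, [/\ p \in net n, q \in net n &
      8 * n%:R * (A * Num.sqrt n%:R) < dot (netpt p) (random_matrix xi w *m netpt q)].
    apply: contrapT => H; move: Ew; rewrite /E/= ltNge => /negP; apply.
    apply: opnorm_le_net => // p q pn qn; rewrite leNgt; apply/negP => pq.
    by apply: H; exists p, q.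
  rewrite /Z (bigD1_seq p) ?mem_enum ?enum_uniq//= (bigD1_seq q) ?mem_enum ?enum_uniq//=.
  apply: (@le_trans _ _ (z p q w)%:E); last first.
    by rewrite -addeA leeDl// adde_ge0// sume_ge0.
  rewrite lee_fin ler_expR -(ler_pM2l sn0) /t mulVKf ?gt_eqF//.
  by rewrite (le_trans _ (ltW pq))//; lra.
have -> : (36 + 256 * kappa - 8 * A) * n%:R
    = (36 + 256 * kappa) * n%:R - 8 * A * n%:R by ring.
rewrite expRD expRN EFinM muleC lee_pdivlMl ?expR_gt0//.
exact: le_trans EZ Zle.
Qed.

End OpnormTail.

(** The tangent bound [1 + ln (x / k) <= x / k], multiplied by [k], gives
    [k * ln x <= k * ln k + x - k]. *)
Lemma powR_le_expR {R : realType} (k x : R) : 0 < k -> 0 < x ->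
  x `^ k <= expR (k * ln k) * expR x.
Proof.
move=> k0 x0; rewrite /powR gt_eqF// -expRD ler_expR.
have := expR_ge1Dx (ln (x / k)).
rewrite lnK ?posrE ?divr_gt0// ln_div ?posrE// ler_pdivlMr//.
lra.
Qed.

Theorem proposition3p1 (R : realType) (B b : R) (hB : 0 < B) (hb : 0 < b) :
  (exists C c : R, 0 < C /\ 0 < c /\
    forall (n : nat) (d : measure_display) (T : measurableType d)
      (P : probability T R) (xi : 'I_n -> 'I_n -> {RV P >-> R}),
      (1 <= n)%N ->
      centered_subgaussian_entries B b xi ->
      forall A : R, C <= A ->
        (P [set w | (A * Num.sqrt n%:R < opnorm (random_matrix xi w))%R]
          <= (C * expR (- c * A * n%:R))%:E)%E)
  /\
  (exists K : R, forall k : R, 0 < k -> exists Ck : R,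
    forall (n : nat) (d : measure_display) (T : measurableType d)
      (P : probability T R) (xi : 'I_n -> 'I_n -> {RV P >-> R}),
      (1 <= n)%N ->
      centered_subgaussian_entries B b xi ->
      ((1 - Ck / (n%:R `^ k))%:E
        <= P [set w | (opnorm (random_matrix xi w) <= K * Num.sqrt n%:R)%R])%E).
Proof.
(* For [A >= C] the exponent coefficient [C - 8 * A] is at most [- A], so the rate [c = 1] works;
   [C >= 1] lets the same constant serve as prefactor. *)
pose kappa := mgf_rate B b; pose C := 36 + 256 * kappa.
have C1 : 1 <= C.
  have : 0 < kappa by exact: mgf_rate_gt0.
  by rewrite /C; lra.
have tail (n : nat) (d : measure_display) (T : measurableType d)
    (P : probability T R) (xi : 'I_n -> 'I_n -> {RV P >-> R}) :
    (1 <= n)%N -> centered_subgaussian_entries B b xi -> forall A : R, C <= A ->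
    (P [set w | (A * Num.sqrt n%:R < opnorm (random_matrix xi w))%R]
      <= (expR (- A * n%:R))%:E)%E.
  move=> n0 xiP A CA; apply: (le_trans (opnorm_tail hB hb xiP _ n0 _)).
    by rewrite (le_trans _ CA)// (le_trans ler01).
  by rewrite lee_fin ler_expR -/kappa ler_wpM2r// -/C; lra.
split.
  exists C, 1; split; first by rewrite (lt_le_trans ltr01).
  split=> // n d T P xi n0 xiP A CA; apply: (le_trans (tail _ _ _ _ _ n0 xiP _ CA)).
  by rewrite lee_fin mulN1r ler_peMl ?expR_ge0.
(* Take [K = C]. The failure probability is at most [expR (- C * n%:R)], and n to the power [k] is
   at most [expR (k * ln k)] times [expR n%:R], where [C >= 1]. *)
exists C => k k0; exists (expR (k * ln k)) => n d T P xi n0 xiP.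
have mE : measurable [set w | C * Num.sqrt n%:R < opnorm (random_matrix xi w)].
  by apply: measurable_opnorm_gt; rewrite mulr_ge0 ?sqrtr_ge0// (le_trans ler01).
have -> : [set w | opnorm (random_matrix xi w) <= C * Num.sqrt n%:R]
    = ~` [set w | C * Num.sqrt n%:R < opnorm (random_matrix xi w)].
  by apply/seteqP; split => w /=; rewrite leNgt => /negP.
rewrite probability_setC// EFinB leeB//.
apply: (le_trans (tail _ _ _ _ _ n0 xiP _ (lexx C))).
have nR0 : 0 < n%:R :> R by rewrite ltr0n.
rewrite lee_fin ler_pdivlMr ?powR_gt0// mulNr expRN mulrC ler_pdivrMr ?expR_gt0//.
rewrite (le_trans (powR_le_expR _ _ k0 nR0))// ler_wpM2l ?expR_ge0// ler_expR.
by rewrite ler_peMl// ltW.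
Qed.
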